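(* Let $(A,\mathfrak m)$ be a Noetherian local ring, let $M$ be a finitely generated $A$-module, let $I$ be an ideal in $A$ and let $i$ be an integer. (a) If $\operatorname{projdim}_A M<\infty$ and $\operatorname{projdim}_A H_j(I,M)<\infty$ for all $j\ne i$, then $\operatorname{projdim}_A H_i(I,M)<\infty$. (b) If $\operatorname{injdim}_A M<\infty$ and $\operatorname{injdim}_A H_j(I,M)<\infty$ for all $j\neq i$, then $\operatorname{injdim}_A H_i(I,M)<\infty$.
   Context: $H_j(I,M)=H_j(\mathbf u,M)$ is the $j$-th Koszul homology module with coefficients in $M$ of a minimal generating set $\mathbf u=u_1,\dots,u_m$ of $I$ (independent, up to isomorphism, of the choice). The zero module is regarded as having finite projective and injective dimension. *)

(* Defs.v *)
From HB Require Import structures.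
From mathcomp Require Import all_boot all_order all_algebra.
From mathcomp Require Import boolp classical_sets.
Set Implicit Arguments.
Unset Strict Implicit.
Unset Printing Implicit Defensive.

Import GRing.Theory.
Local Open Scope classical_set_scope.
Local Open Scope ring_scope.
Local Open Scope quotient_scope.

(* Ideals are arbitrary Prop-valued subsets; the unit ideal is an ideal (the
   [idealr] structure of ring_quotient only covers proper ideals). *)
Definition is_ideal (A : comNzRingType) (I : set A) : Prop :=
  [/\ I 0, forall x y, I x -> I y -> I (x + y) & forall a x, I x -> I (a * x)].

Definition is_maximal_ideal (A : comNzRingType) (I : set A) : Prop :=
  [/\ is_ideal I, I <> setT &
      forall J : set A, is_ideal J -> I `<=` J -> J = I \/ J = setT].

Definition is_local_ring (A : comNzRingType) (mm : set A) : Prop :=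
  is_maximal_ideal mm /\ forall J : set A, is_maximal_ideal J -> J = mm.

(* The ideal generated by the subfamily (u k)_{k in J}. *)
Definition ideal_span (A : comNzRingType) (m : nat) (u : 'I_m -> A)
    (J : {set 'I_m}) : set A :=
  [set x | exists c : 'I_m -> A, x = \sum_(k in J) c k * u k].

Definition noetherian (A : comNzRingType) : Prop :=
  forall I : set A, is_ideal I ->
    exists (m : nat) (u : 'I_m -> A), ideal_span u [set: 'I_m] = I.

(* No proper subfamily of u generates I. *)
Definition minimal_generators (A : comNzRingType) (m : nat) (u : 'I_m -> A)
    (I : set A) : Prop :=
  ideal_span u [set: 'I_m] = I /\
  forall J : {set 'I_m}, ideal_span u J = I -> J = [set: 'I_m]%SET.

Definition finitely_generated (A : comNzRingType) (M : lmodType A) : Prop :=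
  exists (n : nat) (v : 'I_n -> M),
    forall x : M, exists c : 'I_n -> A, x = \sum_(k < n) c k *: v k.

Definition is_projective (A : comNzRingType) (P : lmodType A) : Prop :=
  forall (V W : lmodType A) (g : {linear V -> W}) (f : {linear P -> W}),
    (forall w, exists v, g v = w) ->
    exists h : {linear P -> V}, forall x, g (h x) = f x.

Definition is_injective (A : comNzRingType) (E : lmodType A) : Prop :=
  forall (V W : lmodType A) (g : {linear V -> W}) (f : {linear V -> E}),
    injective g ->
    exists h : {linear W -> E}, forall x, h (g x) = f x.

Definition exact_at (A : comNzRingType) (U V W : lmodType A)
    (f : {linear U -> V}) (g : {linear V -> W}) : Prop :=
  forall v, g v = 0 <-> exists u, f u = v.

Definition is_zero_module (A : comNzRingType) (V : lmodType A) : Prop :=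
  forall x : V, x = 0.

(* 0 -> P n -> ... -> P 0 -> M -> 0, padded with zero modules beyond n. *)
Definition finite_projdim (A : comNzRingType) (M : lmodType A) : Prop :=
  exists (n : nat) (P : nat -> lmodType A)
         (d : forall k, {linear P k.+1 -> P k}) (e : {linear P 0%N -> M}),
    [/\ forall k, is_projective (P k),
        forall k, (n < k)%N -> is_zero_module (P k),
        forall x, exists y, e y = x,
        exact_at (d 0%N) e &
        forall k, exact_at (d k.+1) (d k)].

(* 0 -> M -> E 0 -> ... -> E n -> 0, padded with zero modules beyond n. *)
Definition finite_injdim (A : comNzRingType) (M : lmodType A) : Prop :=
  exists (n : nat) (E : nat -> lmodType A)
         (d : forall k, {linear E k -> E k.+1}) (e : {linear M -> E 0%N}),
    [/\ forall k, is_injective (E k),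
        forall k, (n < k)%N -> is_zero_module (E k),
        injective e,
        exact_at e (d 0%N) &
        forall k, exact_at (d k) (d k.+1)].

Section QuotientModule.
Variables (A : comNzRingType) (V : lmodType A) (N : submodClosed V).

(* [submodClosed] does not inherit from [zmodClosed] in ssralg, whereas
   [Quotient.quot] expects a [zmodClosed]; hence this copy of N. *)
Definition submod_pred : pred V := fun x => x \in N.

HB.instance Definition _ := GRing.isSubmodClosed.Build A V submod_pred
  (submodClosedP N).

Local Notation Q := (Quotient.quot (GRing.ZmodClosed.clone V submod_pred _)).
Definition quotmod : Type := Q.
HB.instance Definition _ := GRing.Zmodule.on quotmod.

Definition quotmod_proj (x : V) : quotmod := \pi_Q x.

Lemma quotmod_projE x y : (quotmod_proj x = quotmod_proj y) <-> (x - y \in N).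
Proof.
have := Quotient.idealrBE (GRing.ZmodClosed.clone V submod_pred _) x y.
rewrite [LHS]unfold_in => ->.
by split=> [/eqP|/eqP].
Qed.

Lemma quotmod_projK (q : quotmod) : quotmod_proj (repr (q : Q)) = q.
Proof. exact: reprK. Qed.

Lemma quotmod_projB : {morph quotmod_proj : x y / x - y}.
Proof. by move=> x y; rewrite /quotmod_proj [LHS]raddfB. Qed.

Lemma quotmod_projD : {morph quotmod_proj : x y / x + y}.
Proof. by move=> x y; rewrite /quotmod_proj [LHS]raddfD. Qed.

Definition quotmod_scale (a : A) (q : quotmod) : quotmod :=
  quotmod_proj (a *: repr (q : Q)).

Lemma quotmod_scaleE a x :
  quotmod_scale a (quotmod_proj x) = quotmod_proj (a *: x).
Proof.
apply/quotmod_projE; rewrite -scalerBr rpredZ //.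
by apply/quotmod_projE/quotmod_projK.
Qed.

Lemma quotmod_scaleA a b q :
  quotmod_scale a (quotmod_scale b q) = quotmod_scale (a * b) q.
Proof. by rewrite -(quotmod_projK q) !quotmod_scaleE scalerA. Qed.

Lemma quotmod_scale1 : left_id 1 quotmod_scale.
Proof. by move=> q; rewrite -(quotmod_projK q) quotmod_scaleE scale1r. Qed.

Lemma quotmod_scaleDr : right_distributive quotmod_scale +%R.
Proof.
move=> a p q; rewrite -(quotmod_projK p) -(quotmod_projK q).
by rewrite -quotmod_projD !quotmod_scaleE scalerDr quotmod_projD.
Qed.

Lemma quotmod_scaleDl q : {morph quotmod_scale^~ q : a b / a + b}.
Proof.
move=> a b; rewrite -(quotmod_projK q) !quotmod_scaleE scalerDl.
exact: quotmod_projD.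
Qed.

HB.instance Definition _ := GRing.Zmodule_isLmodule.Build A quotmod
  quotmod_scaleA quotmod_scale1 quotmod_scaleDr quotmod_scaleDl.

Lemma quotmod_proj_is_linear : linear quotmod_proj.
Proof. by move=> a x y; rewrite quotmod_projD -quotmod_scaleE. Qed.

HB.instance Definition _ := GRing.isLinear.Build A V quotmod _ quotmod_proj
  quotmod_proj_is_linear.

End QuotientModule.

Section Homology.
Variables (A : comNzRingType) (U V W : lmodType A).
Variables (f : {linear U -> V}) (g : {linear V -> W}).

Definition is_cycle : pred V := fun x => g x == 0.

Lemma is_cycle_submod : submod_closed is_cycle.
Proof.
split=> [|a x y]; rewrite !unfold_in /is_cycle ?linear0 //.
by move=> /eqP gx /eqP gy; rewrite linearP gx gy scaler0 addr0.
Qed.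

HB.instance Definition _ := GRing.isSubmodClosed.Build A V is_cycle
  is_cycle_submod.

Definition cycles : Type := {x : V | is_cycle x}.
HB.instance Definition _ := SubChoice.on cycles.
HB.instance Definition _ := [SubChoice_isSubLmodule of cycles by <:].

Definition is_boundary : pred cycles := fun z => `[< exists y, f y = val z >].

Lemma is_boundary_submod : submod_closed is_boundary.
Proof.
split=> [|a x y]; rewrite !unfold_in /is_boundary.
  by apply/asboolP; exists 0; rewrite !linear0.
move=> /asboolP[x' fx] /asboolP[y' fy]; apply/asboolP.
by exists (a *: x' + y'); rewrite !linearP fx fy.
Qed.

HB.instance Definition _ := GRing.isSubmodClosed.Build A cycles is_boundary
  is_boundary_submod.

(* ker g / im f, when g \o f = 0. *)
Definition homology : lmodType A := quotmod (GRing.SubmodClosed.clone A cycles is_boundary _).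

End Homology.

(* The degree j part of the Koszul complex tensored with M: the element c
   stands for the sum of the e_S (x) c S over the j-element subsets S of the
   index set.  The degree ranges over int; the module is zero unless
   0 <= j <= m. *)
Definition koszul_chain (A : comNzRingType) (M : lmodType A) (m : nat)
    (j : int) : lmodType A :=
  {ffun {S : {set 'I_m} | #|S|%:Z == j} -> M}.

Section Koszul.
Variables (A : comNzRingType) (M : lmodType A) (m : nat) (u : 'I_m -> A).

(* e_S (x) x |-> \sum_(k in S) (-1)^(number of l in S with l < k)
                   e_(S \ k) (x) (u_k x).
   The target degree i is a separate argument, to avoid transports between
   (j + 1) - 1 and j; the map vanishes unless j = i + 1. *)
Definition koszul_diff (j i : int) (c : koszul_chain M m j) :
    koszul_chain M m i :=
  [ffun T : {T : {set 'I_m} | #|T|%:Z == i} =>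
    \sum_(S : {S : {set 'I_m} | #|S|%:Z == j})
      \sum_(k in val S | (val S :\ k)%SET == val T)
        ((-1) ^+ #|[set l in val S | (l < k)%N]%SET| * u k) *: c S].

Lemma koszul_diff_is_linear j i : linear (@koszul_diff j i).
Proof.
move=> a c c'; apply/ffunP => T; rewrite !ffunE scaler_sumr -big_split /=.
apply: eq_bigr => S _; rewrite scaler_sumr -big_split /=.
by apply: eq_bigr => k _; rewrite !ffunE scalerDr !scalerA (mulrC a).
Qed.

HB.instance Definition _ j i := GRing.isLinear.Build A (koszul_chain M m j)
  (koszul_chain M m i) _ (@koszul_diff j i) (@koszul_diff_is_linear j i).

Definition koszul_homology (j : int) : lmodType A :=
  homology (@koszul_diff (j + 1) j) (@koszul_diff j (j - 1)).

End Koszul.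

Arguments koszul_diff {A} M {m} u j i c.
Arguments koszul_homology {A} M {m} u j.

(* Main.v *)
(* Modules of finite projective dimension have the two-out-of-three property in
   short exact sequences, and so do modules of finite injective dimension.  In
   a bounded complex whose terms have the property and whose homology has it in
   all degrees but [i], the cycles have it in degrees at most [i] (induction
   upwards from the degrees where the complex vanishes) and the boundaries have
   it in degrees at least [i] (induction downwards); hence so does the quotient
   of cycles by boundaries in degree [i]. *)
Require Import Defs.
From HB Require Import structures.
From mathcomp Require Import all_boot all_order all_algebra.
From mathcomp Require Import boolp classical_sets.
From mathcomp Require Import zify.
Import GRing.Theory.
Local Open Scope ring_scope.
Set Implicit Arguments.
Unset Strict Implicit.
Unset Printing Implicit Defensive.

(** * Kernels, cokernels, images and homology up to isomorphism *)

Section Modules.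
Variable A : comNzRingType.
Implicit Types C D E K L M N P Q U V W X Y : lmodType A.

Definition surj U V (g : U -> V) : Prop := forall y, exists x, g x = y.

Definition ses U V W (f : {linear U -> V}) (g : {linear V -> W}) : Prop :=
  [/\ injective f, exact_at f g & surj g].

Definition mklin U V (h : U -> V) (h_lin : linear h) : {linear U -> V} :=
  HB.pack h (GRing.isLinear.Build A U V _ h h_lin).

Lemma exact_comp U V W (f : {linear U -> V}) (g : {linear V -> W}) :
  exact_at f g -> forall u, g (f u) = 0.
Proof. by move=> fg u; apply/fg; exists u. Qed.

Lemma linear_inj U V (f : {linear U -> V}) :
  (forall x, f x = 0 -> x = 0) -> injective f.
Proof.
move=> f0 x y fxy; apply/eqP; rewrite -subr_eq0; apply/eqP/f0.
by rewrite linearB /= fxy subrr.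
Qed.

Lemma inj_eq0 U V (f : {linear U -> V}) x : injective f -> f x = 0 -> x = 0.
Proof. by move=> f_inj fx0; apply: f_inj; rewrite fx0 linear0. Qed.

Lemma factor_inj K U V (f : {linear K -> V}) (h : {linear U -> V}) :
  injective f -> (forall u, exists k, f k = h u) ->
  exists h' : {linear U -> K}, forall u, f (h' u) = h u.
Proof.
move=> f_inj /boolp.choice[h' h'E].
have h'_lin : linear h'.
  by move=> a x y; apply: f_inj; rewrite linearP !h'E linearP.
by exists (mklin h'_lin).
Qed.

(** For a set-theoretic section [s] of [g], the composite [h \o s] does not depend on the choice of
    [s], because [h] kills the kernel of [g]; this also makes it linear. *)
Lemma factor_surj U V W (g : {linear V -> W}) (h : {linear V -> U}) :
  surj g -> (forall v, g v = 0 -> h v = 0) ->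
  exists h' : {linear W -> U}, forall v, h' (g v) = h v.
Proof.
move=> /boolp.choice[s sE] gh.
have hs v : h (s (g v)) = h v.
  by apply/eqP; rewrite -subr_eq0 -linearB gh // linearB /= sE subrr.
have h'_lin : linear (h \o s).
  by move=> a x y; rewrite /= -linearP /= -(hs (_ + _)) linearP /= !sE.
by exists (mklin h'_lin) => v; apply: hs.
Qed.

Lemma kernel_exists V W (g : {linear V -> W}) :
  exists K (f : {linear K -> V}), injective f /\ exact_at f g.
Proof.
exists (cycles g), (val : {linear cycles g -> V}); split; first exact: val_inj.
move=> v; split=> [gv|[u <-]]; last exact/eqP/(valP u).
have vP : is_cycle g v by apply/eqP.
by exists (Sub v vP); apply: SubK.
Qed.

Section Range.
Variables (U V : lmodType A) (f : {linear U -> V}).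

Definition in_range : pred V := fun v => `[< exists u, f u = v >].

Lemma in_range_submod : submod_closed in_range.
Proof.
split=> [|a _ _ /asboolP[x <-] /asboolP[y <-]]; apply/asboolP.
  by exists 0; rewrite linear0.
by exists (a *: x + y); rewrite linearP.
Qed.

HB.instance Definition _ := GRing.isSubmodClosed.Build A V in_range
  in_range_submod.

Definition coker : lmodType A :=
  quotmod (GRing.SubmodClosed.clone A V in_range _).
Definition coker_proj : {linear V -> coker} := @quotmod_proj A V _.
End Range.

Lemma cokernel_exists U V (f : {linear U -> V}) :
  exists W (g : {linear V -> W}), exact_at f g /\ surj g.
Proof.
exists (coker f), (coker_proj f); split=> [v|w]; last first.
  by exists (repr w); apply: quotmod_projK.
rewrite -(linear0 (coker_proj f)); split.
  by move/quotmod_projE; rewrite subr0 => /asboolP.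
by move=> uv; apply/quotmod_projE; rewrite subr0; apply/asboolP.
Qed.

(** The image is built as the kernel of the cokernel. *)
Lemma image_exists V W (g : {linear V -> W}) :
  exists X (p : {linear V -> X}) (q : {linear X -> W}),
    [/\ surj p, injective q & forall v, q (p v) = g v].
Proof.
have [C [c [gc _]]] := cokernel_exists g.
have [X [q [q_inj qc]]] := kernel_exists c.
have [|p pE] := @factor_inj _ _ _ q g q_inj.
  by move=> v; apply/qc/gc; exists v.
exists X, p, q; split=> // x.
have /gc[v vE] : c (q x) = 0 by apply: (exact_comp qc).
by exists v; apply: q_inj; rewrite pE.
Qed.

(** The sequence from boundaries to cycles to homology. Cycles and boundaries enter through
    arbitrary embeddings [k] and [q], so any kernel and any image can be plugged in. *)
Lemma homology_ses U V W K X (f : {linear U -> V}) (g : {linear V -> W})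
    (k : {linear K -> V}) (q : {linear X -> V}) :
  (forall x, g (f x) = 0) -> injective k -> exact_at k g -> injective q ->
  (forall v, (exists x, q x = v) <-> (exists u, f u = v)) ->
  exists (a : {linear X -> K}) (b : {linear K -> homology f g}), ses a b.
Proof.
move=> gf k_inj kg q_inj qf.
have [|a aE] := @factor_inj _ _ _ k q k_inj.
  by move=> x; apply/kg; have /qf[u <-] : exists x', q x' = q x by exists x.
have [|z zE] := @factor_inj _ _ _ (val : {linear cycles g -> V}) k val_inj.
  move=> x; have xP : is_cycle g (k x) by apply/eqP/(exact_comp kg).
  by exists (Sub (k x) xP); apply: SubK.
pose p : {linear cycles g -> homology f g} := @quotmod_proj A (cycles g) _.
exists a, (p \o z); split=> [x y axy|y|h].
- by apply: q_inj; rewrite -!aE axy.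
- rewrite /= -(linear0 p); split.
    move/quotmod_projE; rewrite subr0 => /asboolP; rewrite zE => /qf[x xE].
    by exists x; apply: k_inj; rewrite aE.
  move=> [x <-]; apply/quotmod_projE; rewrite subr0; apply/asboolP/qf.
  by exists x; rewrite zE aE.
- have [c <-] : exists c, p c = h by exists (repr h); apply: quotmod_projK.
  have /kg[x xE] : g (val c) = 0 by apply/eqP/(valP c).
  by exists x; congr (p _); apply: val_inj; rewrite zE.
Qed.

(** * Two-out-of-three classes and bounded complexes *)

(** Abstracts what finite projective and finite injective dimension have in common, so that the
    argument on complexes is made once for both parts of the theorem. *)
Record thick (F : lmodType A -> Prop) : Prop := Thick {
  thick_zero : forall U, is_zero_module U -> F U;
  thick_ker : forall U V W (f : {linear U -> V}) (g : {linear V -> W}),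
    ses f g -> F V -> F W -> F U;
  thick_ext : forall U V W (f : {linear U -> V}) (g : {linear V -> W}),
    ses f g -> F U -> F W -> F V;
  thick_coker : forall U V W (f : {linear U -> V}) (g : {linear V -> W}),
    ses f g -> F U -> F V -> F W
}.

Section Thick.
Variables (F : lmodType A -> Prop) (F_thick : thick F).

(** Induction on the cardinality of [T]: splitting off one index [t] gives a short exact sequence
    from [M] to the power over [T] to the power over [T] without [t]. *)
Lemma thick_ffun (T : finType) (M : lmodType A) : F M -> F {ffun T -> M}.
Proof.
move=> FM; move: {2}#|T| (erefl #|T|) => n.
elim: n T => [|n IHn] T cardT.
  apply: thick_zero => // c; apply/ffunP => t.
  by have := fintype0 t cardT.
have /card_gt0P[t _] : (0 < #|T|)%N by rewrite cardT.
pose T' : finType := {s : T | s != t}.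
pose f (x : M) : {ffun T -> M} := [ffun s => if s == t then x else 0].
pose g (c : {ffun T -> M}) : {ffun T' -> M} := [ffun s => c (val s)].
have f_lin : linear f.
  move=> a x y; apply/ffunP => s; rewrite !ffunE.
  by case: eqP => //; rewrite scaler0 addr0.
have g_lin : linear g by move=> a x y; apply/ffunP => s; rewrite !ffunE.
apply: (@thick_ext _ F_thick _ _ _ (mklin f_lin) (mklin g_lin)) => //;
  last first.
  by apply: IHn; rewrite card_sig cardC1 cardT.
split=> [x y /ffunP/(_ t)|c|c] /=; first by rewrite !ffunE eqxx.
- split=> [gc0|[x <-]]; last first.
    by apply/ffunP => s; rewrite !ffunE (negPf (valP s)).
  exists (c t); apply/ffunP => s; rewrite !ffunE; case: eqP => [->//|/eqP st].
  by have /ffunP/(_ (Sub s st)) := gc0; rewrite !ffunE.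
(* Extension by zero at the omitted index [t]. *)
exists [ffun s => if insub s is Some s' then c s' else 0].
by apply/ffunP => s; rewrite !ffunE valK.
Qed.

Section Complex.
Variables (C : int -> lmodType A) (d : forall j i, {linear C j -> C i}).
Variables (m : nat) (i : int).
Hypothesis d_comp : forall j x, d j (j - 1) (d (j + 1) j x) = 0.
Hypothesis C_neg : forall j : int, j < 0 -> is_zero_module (C j).
Hypothesis C_large : forall j : int, m%:Z < j -> is_zero_module (C j).
Hypothesis FC : forall j, F (C j).
Hypothesis FH :
  forall j : int, j <> i -> F (homology (d (j + 1) j) (d j (j - 1))).

(** Quantifying over all embeddings onto the cycles avoids transporting [F] along isomorphisms
    between models of the same submodule. *)
Let F_cycles (j : int) := forall K (k : {linear K -> C j}),
  injective k -> exact_at k (d j (j - 1)) -> F K.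

Let F_boundaries (j : int) := forall X (q : {linear X -> C j}),
  injective q ->
  (forall v, (exists x, q x = v) <-> (exists u, d (j + 1) j u = v)) ->
  F X.

(** The strict upper bound [n] on [j] drives the induction; for [n = 0] the chain module vanishes.
    For the step, [F] passes from the cycles in degree [j - 1] to the boundaries there, as [j - 1]
    differs from [i], and then to the cycles in degree [j], the kernel of the map from [C j] onto
    those boundaries. *)
Lemma cycles_low (n : nat) (j : int) : j < n%:Z -> j <= i -> F_cycles j.
Proof.
elim: n j => [|n IHn] j jn ji K k k_inj kd.
  apply: thick_zero => // x; apply: inj_eq0 k_inj _.
  by apply: C_neg.
have [jn'|nj] := boolP (j < n%:Z); first exact: (IHn j) kd.
(* The homology in degree [j - 1] mentions the degree [j - 1 + 1], which equals [j] only
   propositionally, so differentials must be rewritten along this equality. *)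
have jE : (j - 1) + 1 = j by rewrite subrK.
have [X [p [q [p_surj q_inj qp]]]] := image_exists (d j (j - 1)).
have qd v : (exists x, q x = v) <-> (exists u, d (j - 1 + 1) (j - 1) u = v).
  rewrite jE; split=> [[x <-]|[u <-]]; last by exists (p u).
  by have [u <-] := p_surj x; exists u.
have [Z [z [z_inj zd]]] := kernel_exists (d (j - 1) (j - 1 - 1)).
have [a [b ab]] := homology_ses (@d_comp (j - 1)) z_inj zd q_inj qd.
have FX : F X.
  apply: (thick_ker F_thick ab); last by apply: FH; lia.
  by apply: IHn zd => //; lia.
apply: (@thick_ker _ F_thick _ _ _ k p) => //; split=> // v.
split=> [pv0|[x <-]]; first by apply/kd; rewrite -qp pv0 linear0.
by apply: inj_eq0 q_inj _; rewrite qp (exact_comp kd).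
Qed.

(** Here [n] bounds the distance from [j] up to [m]; for [n = 0] the module [C (j + 1)] vanishes,
    hence so do the boundaries in degree [j]. For the step, the cycles in degree [j + 1] extend the
    homology there, with [j + 1] different from [i], by the boundaries, and the boundaries in degree
    [j] are the quotient of [C (j + 1)] by these cycles. *)
Lemma boundaries_high (n : nat) (j : int) :
  m%:Z <= j + n%:Z -> i <= j -> F_boundaries j.
Proof.
elim: n j => [|n IHn] j jn ij X q q_inj qd.
  apply: thick_zero => // x; apply: inj_eq0 q_inj _.
  have /qd[u <-] : exists x', q x' = q x by exists x.
  by rewrite (C_large _ u) ?linear0 //; lia.
have jE : j + 1 - 1 = j by rewrite addrK.
have [Z [z [z_inj zd]]] := kernel_exists (d (j + 1) (j + 1 - 1)).
have [Y [p0 [y [p0_surj y_inj yp]]]] := image_exists (d (j + 1 + 1) (j + 1)).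
have yd v : (exists x, y x = v) <-> (exists u, d (j + 1 + 1) (j + 1) u = v).
  split=> [[x <-]|[u <-]]; last by rewrite -yp; eexists.
  by have [u <-] := p0_surj x; exists u; rewrite yp.
have [a [b ab]] := homology_ses (@d_comp (j + 1)) z_inj zd y_inj yd.
have FZ : F Z.
  apply: (thick_ext F_thick ab); last by apply: FH; lia.
  by apply: IHn yd => //; lia.
have [|p pE] := @factor_inj _ _ _ q (d (j + 1) j) q_inj.
  by move=> u; apply/qd; exists u.
apply: (@thick_coker _ F_thick _ _ _ z p) => //; split=> // [v|x].
  split=> [pv0|[w <-]].
    by apply/zd; rewrite jE -pE pv0 linear0.
  apply: inj_eq0 q_inj _; rewrite pE; move: zd; rewrite jE => zd.
  exact: (exact_comp zd).
have /qd[u uE] : exists x', q x' = q x by exists x.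
by exists u; apply: q_inj; rewrite pE.
Qed.

Lemma complex_homology_thick : F (homology (d (i + 1) i) (d i (i - 1))).
Proof.
have [Z [z [z_inj zd]]] := kernel_exists (d i (i - 1)).
have [Y [p0 [y [p0_surj y_inj yp]]]] := image_exists (d (i + 1) i).
have yd v : (exists x, y x = v) <-> (exists u, d (i + 1) i u = v).
  split=> [[x <-]|[u <-]]; last by rewrite -yp; eexists.
  by have [u <-] := p0_surj x; exists u; rewrite yp.
have [a [b ab]] := homology_ses (@d_comp i) z_inj zd y_inj yd.
apply: (thick_coker F_thick ab).
  (* The summand [|i|] makes the bound hold for negative [i] too. *)
  by apply: (@boundaries_high (`|i| + m)%N) yd => //; lia.
by apply: (@cycles_low `|i|.+1) zd => //; lia.
Qed.
End Complex.
End Thick.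

(** * Constructions on short exact sequences *)

Lemma zero_injective U V (f : {linear U -> V}) :
  is_zero_module U -> injective f.
Proof. by move=> U0 x y _; rewrite (U0 x) (U0 y). Qed.

(* For a surjection [p] onto the middle term, the kernels of [p] and of its
   composite with [g] form a short exact sequence
   [0 -> ker p -> N -> U -> 0]. *)
Lemma ses_kernel_comp K U V W X (f : {linear U -> V}) (g : {linear V -> W})
    (k : {linear K -> X}) (p : {linear X -> V}) :
  ses f g -> ses k p ->
  exists N (n : {linear N -> X}) (h : {linear X -> W})
         (a : {linear K -> N}) (b : {linear N -> U}),
    ses n h /\ ses a b.
Proof.
move=> [f_inj fg g_surj] [k_inj kp p_surj].
have [N [n [n_inj nh]]] := kernel_exists (g \o p : {linear X -> W}).
have [|a aE] := @factor_inj _ _ _ n k n_inj.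
  by move=> x; apply/nh; rewrite /= (exact_comp kp x) linear0.
have [|b bE] := @factor_inj _ _ _ f (p \o n : {linear N -> V}) f_inj.
  by move=> x; apply/fg; exact: (exact_comp nh x).
exists N, n, (g \o p : {linear X -> W}), a, b; split.
- split=> // w; have [v <-] := g_surj w; have [x <-] := p_surj v.
  by exists x.
- split=> [x y axy|x|y].
  + by apply: k_inj; rewrite -!aE axy.
  + split=> [bx0|[y <-]].
      have /kp[y yE] : p (n x) = 0 by rewrite -[LHS]bE bx0 linear0.
      by exists y; apply: n_inj; rewrite aE.
    by apply: f_inj; rewrite bE /= aE linear0 (exact_comp kp).
  + have [x xE] := p_surj (f y).
    have /nh[z zE] : (g \o p) x = 0 by rewrite /= xE (exact_comp fg).
    by exists z; apply: f_inj; rewrite bE /= zE.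
Qed.

(* Dually, for an embedding [e] of the middle term:
   [0 -> W -> coker (e \o f) -> coker e -> 0]. *)
Lemma ses_cokernel_comp C U V W X (f : {linear U -> V}) (g : {linear V -> W})
    (e : {linear V -> X}) (c : {linear X -> C}) :
  ses f g -> ses e c ->
  exists N (h : {linear U -> X}) (n : {linear X -> N})
         (a : {linear W -> N}) (b : {linear N -> C}),
    ses h n /\ ses a b.
Proof.
move=> [f_inj fg g_surj] [e_inj ec c_surj].
have [N [n [hn n_surj]]] := cokernel_exists (e \o f : {linear U -> X}).
have [|a aE] := @factor_surj _ _ _ g (n \o e : {linear V -> N})
  g_surj.
  by move=> v /fg[u <-]; apply: (exact_comp hn u).
have [|b bE] := @factor_surj _ _ _ n c n_surj.
  by move=> x /hn[u <-]; apply: (exact_comp ec (f u)).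
exists N, (e \o f : {linear U -> X}), n, a, b; split.
- by split=> // x y /e_inj/f_inj.
- split=> [|y|y].
  + apply: linear_inj => w; have [v <-] := g_surj w.
    by rewrite aE => /hn[u /e_inj <-]; apply: (exact_comp fg u).
  + have [x <-] := n_surj y; split=> [|[w]].
      by rewrite bE => /ec[v <-]; exists (g v); rewrite aE.
    have [v <-] := g_surj w; rewrite aE => <-.
    by rewrite bE (exact_comp ec).
  + by have [x <-] := c_surj y; exists (n x); rewrite bE.
Qed.

(** [Y] is the fibre product of [V] and [X] over [W], the kernel of the difference map [h]; each
    projection is onto, with the kernel of the opposite map as its kernel. *)
Lemma ses_pullback K U V W X (f : {linear U -> V}) (g : {linear V -> W})
    (k : {linear K -> X}) (p : {linear X -> W}) :
  ses f g -> ses k p ->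
  exists Y (a : {linear U -> Y}) (b : {linear Y -> X})
           (c : {linear K -> Y}) (d : {linear Y -> V}), ses a b /\ ses c d.
Proof.
move=> [f_inj fg g_surj] [k_inj kp p_surj].
pose h : {linear (V * X)%type -> W} := (g \o fst) \- (p \o snd).
have [Y [y [y_inj yh]]] := kernel_exists h.
have yE z : g (y z).1 = p (y z).2.
  by apply/eqP; rewrite -subr_eq0; apply/eqP/(exact_comp yh z).
have i1_lin : linear (fun x : U => (f x, 0) : V * X).
  by move=> s x x'; rewrite linearP; congr pair; rewrite /= scaler0 addr0.
have i2_lin : linear (fun x : K => (0, k x) : V * X).
  by move=> s x x'; rewrite linearP; congr pair; rewrite /= scaler0 addr0.
have [|a aE] := @factor_inj _ _ _ y (mklin i1_lin) y_inj.
  by move=> x; apply/yh; rewrite /= linear0 (exact_comp fg x) subr0.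
have [|c cE] := @factor_inj _ _ _ y (mklin i2_lin) y_inj.
  by move=> x; apply/yh; rewrite /= linear0 (exact_comp kp x) subr0.
exists Y, a, (snd \o y : {linear Y -> X}), c, (fst \o y : {linear Y -> V}).
split; split=> [x x' /(congr1 y)|z|x] /=.
- by rewrite !aE => -[/f_inj].
- split=> [z0|[x <-]]; last by rewrite aE.
  have /fg[x xE] : g (y z).1 = 0 by rewrite yE z0 linear0.
  by exists x; apply: y_inj; rewrite aE /= xE -z0; case: (y z).
- have [v vE] := g_surj (p x).
  have /yh[z zE] : h (v, x) = 0 by rewrite /= vE subrr.
  by exists z; rewrite zE.
- by rewrite !cE => -[/k_inj].
- split=> [z0|[x <-]]; last by rewrite cE.
  have /kp[x xE] : p (y z).2 = 0 by rewrite -yE z0 linear0.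
  by exists x; apply: y_inj; rewrite cE /= xE -z0; case: (y z).
- have [v vE] := p_surj (g x).
  have /yh[z zE] : h (x, v) = 0 by rewrite /= vE subrr.
  by exists z; rewrite zE.
Qed.

(** [Y] is the amalgamated sum of [V] and [X] over [U], that is, the quotient of the product by all
    pairs [(f u, - e u)]. *)
Lemma ses_pushout C U V W X (f : {linear U -> V}) (g : {linear V -> W})
    (e : {linear U -> X}) (c : {linear X -> C}) :
  ses f g -> ses e c ->
  exists Y (a : {linear X -> Y}) (b : {linear Y -> W})
           (j : {linear V -> Y}) (q : {linear Y -> C}), ses a b /\ ses j q.
Proof.
move=> [f_inj fg g_surj] [e_inj ec c_surj].
have h_lin : linear (fun x : U => (f x, - e x) : V * X).
  by move=> s x x'; rewrite !linearP; congr pair; rewrite /= scalerN opprD.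
have [Y [y [hy y_surj]]] := cokernel_exists (mklin h_lin).
have i1_lin : linear (fun x : X => (0, x) : V * X).
  by move=> s x x'; congr pair; rewrite /= scaler0 addr0.
have i2_lin : linear (fun x : V => (x, 0) : V * X).
  by move=> s x x'; congr pair; rewrite /= scaler0 addr0.
have [|b bE] := @factor_surj _ _ _ y (g \o fst : {linear (V * X)%type -> W})
  y_surj.
  by move=> _ /hy[u <-] /=; apply: (exact_comp fg).
have [|q qE] := @factor_surj _ _ _ y (c \o snd : {linear (V * X)%type -> C})
  y_surj.
  by move=> _ /hy[u <-] /=; rewrite linearN (exact_comp ec) ?oppr0.
(* Changing the representative of a class by an element of [U] later makes one of its coordinates
   vanish. *)
have yE v x u : y (v, x) = y (v - f u, x + e u).
  apply/eqP; rewrite -subr_eq0 -linearB; apply/eqP/hy; exists u => /=.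
  congr pair => /=; first by rewrite opprB addrC subrK.
  by rewrite opprD addrA subrr sub0r.
exists Y, (y \o mklin i1_lin : {linear X -> Y}), b,
  (y \o mklin i2_lin : {linear V -> Y}), q.
split; split=> [|z|w].
- apply: linear_inj => x /= /hy[u] [/(inj_eq0 f_inj) ->].
  by rewrite linear0 oppr0.
- split=> [|[x <-]]; last by rewrite bE /= linear0.
  have [[v x] <-] := y_surj z; rewrite bE /= => /fg[u uE].
  by exists (x + e u); rewrite (yE v x u) uE subrr.
- by have [v <-] := g_surj w; exists (y (v, 0)); rewrite bE.
- apply: linear_inj => v /= /hy[u] [<- /eqP].
  by rewrite oppr_eq0 => /eqP/(inj_eq0 e_inj) ->; rewrite linear0.
- split=> [|[v <-]]; last by rewrite qE /= linear0.
  have [[v x] <-] := y_surj z; rewrite qE /= => /ec[u uE].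
  by exists (v + f u); rewrite (yE (v + f u) 0 u) addrK add0r uE.
- by have [x <-] := c_surj w; exists (y (0, x)); rewrite qE.
Qed.

(** * Projective and injective modules *)

Lemma projective_zero U : is_zero_module U -> is_projective U.
Proof.
move=> U0 V W g f _; exists \0 => x.
by rewrite (U0 x) !linear0.
Qed.

Lemma injective_zero U : is_zero_module U -> is_injective U.
Proof.
move=> U0 V W g f _; exists \0 => x.
by rewrite (U0 (f x)).
Qed.

Lemma projective_pair P Q :
  is_projective P -> is_projective Q -> is_projective (P * Q)%type.
Proof.
move=> P_proj Q_proj V W g f g_surj.
have i1_lin : linear (fun x : P => (x, 0) : P * Q).
  by move=> s x x'; congr pair; rewrite /= scaler0 addr0.
have i2_lin : linear (fun x : Q => (0, x) : P * Q).
  by move=> s x x'; congr pair; rewrite /= scaler0 addr0.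
have [h1 h1E] := P_proj V W g (f \o mklin i1_lin) g_surj.
have [h2 h2E] := Q_proj V W g (f \o mklin i2_lin) g_surj.
exists ((h1 \o fst) \+ (h2 \o snd) : {linear (P * Q)%type -> V}) => -[x y] /=.
rewrite linearD h1E h2E /= -linearD; congr (f _); congr pair.
  by rewrite addr0.
by rewrite add0r.
Qed.

Lemma injective_pair E E' :
  is_injective E -> is_injective E' -> is_injective (E * E')%type.
Proof.
move=> E_inj F_inj V W g f g_inj.
have [h1 h1E] := E_inj V W g (fst \o f) g_inj.
have [h2 h2E] := F_inj V W g (snd \o f) g_inj.
have h_lin : linear (fun x => (h1 x, h2 x)).
  by move=> s x y; congr pair; apply: linearP.
by exists (mklin h_lin) => x /=; rewrite h1E h2E /=; case: (f x).
Qed.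

(** Since [Q] is projective the sequence splits: [idfun \- (s \o g)] lands in the kernel of [g] and
    yields a retraction [r] of [f], so [K] is a direct summand of [P]. *)
Lemma projective_ses_kernel K P Q (f : {linear K -> P}) (g : {linear P -> Q}) :
  ses f g -> is_projective P -> is_projective Q -> is_projective K.
Proof.
move=> [f_inj fg g_surj] P_proj Q_proj.
have [s sE] := Q_proj _ _ g idfun g_surj.
have [|r rE] := @factor_inj _ _ _ f (idfun \- (s \o g) : {linear P -> P}) f_inj.
  by move=> x; apply/fg; rewrite /= linearB sE subrr.
move=> V W p h p_surj; have [t tE] := P_proj V W p (h \o r) p_surj.
exists (t \o f) => x; rewrite /= tE /=; congr (h _).
by apply: f_inj; rewrite rE /= (exact_comp fg) // linear0 subr0.
Qed.

(** Since [E] is injective the sequence splits: [idfun \- (f \o s)] kills the image of [f] and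
    yields a section [r] of [g]. *)
Lemma injective_ses_cokernel E (F : lmodType A) C
    (f : {linear E -> F}) (g : {linear F -> C}) :
  ses f g -> is_injective E -> is_injective F -> is_injective C.
Proof.
move=> [f_inj fg g_surj] E_inj F_inj.
have [s sE] := E_inj _ _ f idfun f_inj.
have [|r rE] := @factor_surj _ _ _ g (idfun \- (f \o s) : {linear F -> F})
  g_surj.
  by move=> _ /fg[u <-]; rewrite /= sE subrr.
move=> V W j h j_inj; have [t tE] := F_inj V W j (r \o h) j_inj.
exists (g \o t) => x; rewrite /= tE /=; have [y <-] := g_surj (h x).
by rewrite rE /= linearB (exact_comp fg) // subr0.
Qed.

(** * Dimension bounds by successive syzygies and cosyzygies *)

(** Projective dimension less than [n]. The strict bound makes the zero module the base case, and a
    resolution is unrolled one short exact sequence at a time. *)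
Fixpoint pd_lt (n : nat) (M : lmodType A) : Prop :=
  if n is n'.+1 then
    exists K P (f : {linear K -> P}) (g : {linear P -> M}),
      [/\ is_projective P, ses f g & pd_lt n' K]
  else is_zero_module M.

Fixpoint id_lt (n : nat) (M : lmodType A) : Prop :=
  if n is n'.+1 then
    exists E C (f : {linear M -> E}) (g : {linear E -> C}),
      [/\ is_injective E, ses f g & id_lt n' C]
  else is_zero_module M.

Lemma ses_zero_id U :
  is_zero_module U -> ses (\0 : {linear U -> U}) (idfun : {linear U -> U}).
Proof.
move=> U0; split=> [|v|w]; first exact: zero_injective.
  by split=> _; [exists 0 | ]; rewrite (U0 v).
by exists w.
Qed.

Lemma ses_id_zero U :
  is_zero_module U -> ses (idfun : {linear U -> U}) (\0 : {linear U -> U}).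
Proof.
move=> U0; split=> [|v|w]; first exact: zero_injective.
  by split=> // _; exists v.
by exists w; rewrite (U0 w).
Qed.

Lemma pd_lt_mono n p M : (n <= p)%N -> pd_lt n M -> pd_lt p M.
Proof.
elim: n p M => [|n IHn] [|p] M //= np.
  move=> M0; exists M, M, \0, idfun; split; first exact: projective_zero.
    exact: ses_zero_id.
  (* A zero module covers itself with zero kernel, which pads the resolution to any length. *)
  by elim: p np => // p IHp _; exists M, M, \0, idfun; split;
    [exact: projective_zero | exact: ses_zero_id | exact: IHp].
by move=> [K [P [f [g [P_proj fg /IHn-/(_ p np) Kp]]]]]; exists K, P, f, g.
Qed.

Lemma id_lt_mono n p M : (n <= p)%N -> id_lt n M -> id_lt p M.
Proof.
elim: n p M => [|n IHn] [|p] M //= np.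
  move=> M0; exists M, M, idfun, \0; split; first exact: injective_zero.
    exact: ses_id_zero.
  by elim: p np => // p IHp _; exists M, M, idfun, \0; split;
    [exact: injective_zero | exact: ses_id_zero | exact: IHp].
by move=> [E [C [f [g [E_inj fg /IHn-/(_ p np) Cp]]]]]; exists E, C, f, g.
Qed.

(** Forwards, replace the module by the kernel of its augmentation and shift the resolution;
    backwards, splice the cover with a resolution of its kernel. *)
Lemma finite_projdimE M : finite_projdim M <-> exists n, pd_lt n M.
Proof.
split=> [[n [P [d [e [P_proj P0 e_surj de dd]]]]]|[n]].
  (* Terms in degrees [0] to [n] make [n.+1] short exact sequences. *)
  exists n.+1.
  elim: n M P d e P_proj P0 e_surj de dd =>
    [|n IHn] M P d e P_proj P0 e_surj de dd.
    have [K [k [k_inj ke]]] := kernel_exists e.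
    exists K, (P 0%N), k, e; split=> //= x.
    apply: (inj_eq0 k_inj); have /de[y <-] := (exact_comp ke x).
    by rewrite (P0 1%N isT y) linear0.
  have [K [k [k_inj ke]]] := kernel_exists e.
  exists K, (P 0%N), k, e; split=> //.
  have [|e' e'E] := @factor_inj _ _ _ k (d 0%N) k_inj.
    by move=> x; apply/ke/de; exists x.
  apply: (IHn K (fun j => P j.+1) (fun j => d j.+1) e') => //.
  - by move=> j nj; apply: P0.
  - move=> x; have /de[y yE] := (exact_comp ke x).
    by exists y; apply: k_inj; rewrite e'E.
  - move=> x; split=> [e'x|[y <-]]; first by apply/dd; rewrite -e'E e'x linear0.
    by apply: k_inj; rewrite e'E linear0; apply: (exact_comp (dd 0%N) y).
elim: n M => [|n IHn] M /=.
  move=> M0; exists 0%N, (fun=> M), (fun=> \0), idfun; split=> //.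
  - by move=> _; apply: projective_zero.
  - by move=> x; exists x.
  - by move=> x; split=> _; [exists 0|]; rewrite (M0 x).
  - by move=> _ x; split=> _ //; exists 0; rewrite (M0 x).
move=> [K [Q [f [g [Q_proj [f_inj fg g_surj]]]]]].
move=> /IHn[p [P [d [e [P_proj P0 e_surj de dd]]]]].
pose P' j := if j is j'.+1 then P j' else Q.
(* The splice in degree [0] is the augmentation of the resolution of [K] followed by the inclusion
   into [Q]. *)
pose d' j : {linear P' j.+1 -> P' j} :=
  if j is j'.+1 return {linear P' j.+1 -> P' j} then d j' else f \o e.
exists p.+1, P', d', g; split=> //.
- by case=> // j; apply: P_proj.
- by case=> // j pj; apply: P0.
- move=> x; split=> [/fg[y <-]|[y <-]]; last exact: (exact_comp fg).
  by have [z <-] := e_surj y; exists z.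
- case=> [|j] //= x; split=> [|[y <-] /=].
    by rewrite /= => /(inj_eq0 f_inj)/de.
  by rewrite (exact_comp de y) linear0.
Qed.

Lemma finite_injdimE M : finite_injdim M <-> exists n, id_lt n M.
Proof.
split=> [[n [E [d [e [E_inj E0 e_inj ed dd]]]]]|[n]].
  exists n.+1.
  elim: n M E d e E_inj E0 e_inj ed dd => [|n IHn] M E d e E_inj E0 e_inj ed dd.
    have [C [c [ec c_surj]]] := cokernel_exists e.
    exists (E 0%N), C, e, c; split=> //= y; have [x <-] := c_surj y.
    by apply/ec/ed; apply: E0.
  have [C [c [ec c_surj]]] := cokernel_exists e.
  exists (E 0%N), C, e, c; split=> //.
  have [|e' e'E] := @factor_surj _ _ _ c (d 0%N) c_surj.
    by move=> x /ec/ed.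
  apply: (IHn C (fun j => E j.+1) (fun j => d j.+1) e') => //.
  - by move=> j nj; apply: E0.
  - apply: linear_inj => y; have [x <-] := c_surj y.
    by rewrite e'E => /ed/ec.
  - move=> x; split=> [/dd[y <-]|[y <-]]; first by exists (c y); rewrite e'E.
    by have [z <-] := c_surj y; rewrite e'E; apply: (exact_comp (dd 0%N) z).
elim: n M => [|n IHn] M /=.
  move=> M0; exists 0%N, (fun=> M), (fun=> \0), idfun; split=> //.
  - by move=> _; apply: injective_zero.
  - by move=> x; split=> _ //; exists x.
  - by move=> _ x; split=> _ //; exists 0; rewrite (M0 x).
move=> [F [C [f [g [F_inj [f_inj fg g_surj]]]]]].
move=> /IHn[p [E [d [e [E_inj E0 e_inj ed dd]]]]].
pose E' j := if j is j'.+1 then E j' else F.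
pose d' j : {linear E' j -> E' j.+1} :=
  if j is j'.+1 return {linear E' j -> E' j.+1} then d j' else e \o g.
exists p.+1, E', d', f; split=> //.
- by case=> // j; apply: E_inj.
- by case=> // j pj; apply: E0.
- move=> x; split=> [/= /(inj_eq0 e_inj)/fg //|[y <-] /=].
  by rewrite (exact_comp fg) // linear0.
- case=> [|j] x; last exact: dd.
  split=> [/ed[y <-]|[y <-] /=]; last exact: (exact_comp ed).
  by have [z <-] := g_surj y; exists z.
Qed.

(* Horseshoe lemma: resolve the middle term by the direct sum. *)
Lemma pd_lt_ext n U V W (f : {linear U -> V}) (g : {linear V -> W}) :
  ses f g -> pd_lt n U -> pd_lt n W -> pd_lt n V.
Proof.
elim: n U V W f g => [|n IHn] U V W f g [f_inj fg g_surj] /=.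
  move=> U0 W0 v; have /fg[u <-] : g v = 0 by apply: W0.
  by rewrite (U0 u) linear0.
move=> [K [P [k [p [P_proj [k_inj kp p_surj] Kn]]]]].
move=> [L [Q [l [q [Q_proj [l_inj lq q_surj] Ln]]]]].
have [t tE] := Q_proj _ _ g q g_surj.
pose h : {linear (P * Q)%type -> V} := (f \o p \o fst) \+ (t \o snd).
have gh x : g (h x) = q x.2 by rewrite /= linearD (exact_comp fg) // add0r tE.
have [N [n' [n'_inj n'h]]] := kernel_exists h.
have i_lin : linear (fun x : K => (k x, 0) : P * Q).
  by move=> s x x'; rewrite linearP; congr pair; rewrite /= scaler0 addr0.
have [|a aE] := @factor_inj _ _ _ n' (mklin i_lin) n'_inj.
  by move=> x; apply/n'h; rewrite /= (exact_comp kp x) !linear0 addr0.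
have [|b bE] := @factor_inj _ _ _ l (snd \o n' : {linear N -> Q}) l_inj.
  by move=> x; apply/lq; rewrite -[LHS]gh (exact_comp n'h x) linear0.
exists N, (P * Q)%type, n', h; split; first exact: projective_pair.
  split=> // v; have [y yE] := q_surj (g v).
  have /fg[u uE] : g (v - t y) = 0 by rewrite linearB tE yE subrr.
  by have [x xE] := p_surj u; exists (x, y); rewrite /= xE uE subrK.
apply: (IHn _ _ _ a b) => //; split=> [x y /(congr1 n')|x|y].
- by rewrite !aE => -[/k_inj].
- split=> [bx0|[y <-]].
    have x2 : (n' x).2 = 0 by rewrite -[LHS]bE bx0 linear0.
    have /kp[y yE] : p (n' x).1 = 0.
      apply: (inj_eq0 f_inj); have := (exact_comp n'h x).
      by rewrite /= x2 linear0 addr0.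
    by exists y; apply: n'_inj; rewrite aE /= yE -x2; case: (n' x).
  by apply: (inj_eq0 l_inj); rewrite bE /= aE.
- have /fg[u uE] : g (t (l y)) = 0 by rewrite tE (exact_comp lq).
  have [x xE] := p_surj u.
  (* The element [t (l y)] comes from [U]; the first coordinate [- x] cancels it. *)
  have /n'h[z zE] : h (- x, l y) = 0 by rewrite /= !linearN xE uE addNr.
  by exists z; apply: l_inj; rewrite bE /= zE.
Qed.

(** Dual horseshoe: extend [e] along [f] to [t] by injectivity of [E], and embed [V] in [E * F] by
    [t] and [k \o g]. The cokernels again form a short exact sequence. *)
Lemma id_lt_ext n U V W (f : {linear U -> V}) (g : {linear V -> W}) :
  ses f g -> id_lt n U -> id_lt n W -> id_lt n V.
Proof.
elim: n U V W f g => [|n IHn] U V W f g [f_inj fg g_surj] /=.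
  move=> U0 W0 v; have /fg[u <-] : g v = 0 by apply: W0.
  by rewrite (U0 u) linear0.
move=> [E [C [e [c [E_inj [e_inj ec c_surj] Cn]]]]].
move=> [F [D [k [p [F_inj [k_inj kp p_surj] Dn]]]]].
have [t tE] := E_inj _ _ f e f_inj.
have h_lin : linear (fun v : V => (t v, k (g v)) : E * F).
  by move=> s x x'; congr pair; rewrite !linearP.
have [N [y [hy y_surj]]] := cokernel_exists (mklin h_lin).
have i_lin : linear (fun x : E => (x, 0) : E * F).
  by move=> s x x'; congr pair; rewrite /= scaler0 addr0.
have [|a aE] := @factor_surj _ _ _ c (y \o mklin i_lin : {linear E -> N})
  c_surj.
  move=> _ /ec[u <-]; apply/hy; exists (f u).
  by rewrite /= tE (exact_comp fg) // linear0.
have [|b bE] := @factor_surj _ _ _ y (p \o snd : {linear (E * F)%type -> D})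
  y_surj.
  by move=> _ /hy[v <-]; rewrite /= (exact_comp kp).
exists (E * F)%type, N, (mklin h_lin), y; split; first exact: injective_pair.
  split=> //; apply: linear_inj => v [tv /(inj_eq0 k_inj)/fg[u uE]].
  by move: tv; rewrite -uE tE => /(inj_eq0 e_inj) ->; rewrite linear0.
apply: (IHn _ _ _ a b) => //; split=> [|z|z].
- apply: linear_inj => x; have [w <-] := c_surj x; rewrite aE => /hy[v] [<-].
  by move=> /(inj_eq0 k_inj)/fg[u <-]; rewrite tE (exact_comp ec).
- split=> [|[x <-]]; last first.
    by have [w <-] := c_surj x; rewrite aE bE /= linear0.
  have [[x w] <-] := y_surj z; rewrite bE /= => /kp[w' w'E].
  have [v vE] := g_surj w'.
  (* Subtracting the image [(t v, w)] of [v] from [(x, w)] moves the class into the first factor. *)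
  exists (c (x - t v)); rewrite aE /=; apply/eqP; rewrite -subr_eq0 -linearB.
  apply/eqP/hy; exists (- v); rewrite /= !linearN vE w'E; congr pair.
    by rewrite [_ - x]addrC addKr.
  by rewrite sub0r.
- by have [x <-] := p_surj z; exists (y (0, x)); rewrite bE.
Qed.

(** * Finite projective and finite injective dimension are two-out-of-three classes *)

Lemma finite_projdim_ext U V W (f : {linear U -> V}) (g : {linear V -> W}) :
  ses f g -> finite_projdim U -> finite_projdim W -> finite_projdim V.
Proof.
move=> fg /finite_projdimE[n Un] /finite_projdimE[p Wp]; apply/finite_projdimE.
exists (maxn n p); apply: (pd_lt_ext fg).
  by apply: pd_lt_mono Un; rewrite leq_maxl.
by apply: pd_lt_mono Wp; rewrite leq_maxr.
Qed.

Lemma finite_injdim_ext U V W (f : {linear U -> V}) (g : {linear V -> W}) :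
  ses f g -> finite_injdim U -> finite_injdim W -> finite_injdim V.
Proof.
move=> fg /finite_injdimE[n Un] /finite_injdimE[p Wp]; apply/finite_injdimE.
exists (maxn n p); apply: (id_lt_ext fg).
  by apply: id_lt_mono Un; rewrite leq_maxl.
by apply: id_lt_mono Wp; rewrite leq_maxr.
Qed.

Lemma finite_projdim_cover M : finite_projdim M <->
  exists K P (f : {linear K -> P}) (g : {linear P -> M}),
    [/\ is_projective P, ses f g & finite_projdim K].
Proof.
(* Raising the bound to [n.+1] provides a cover even when [n = 0]. *)
rewrite finite_projdimE; split=> [[n /(pd_lt_mono (leqnSn n))]|].
  move=> [K [P [f [g [P_proj fg Kn]]]]]; exists K, P, f, g; split=> //.
  by apply/finite_projdimE; exists n.
move=> [K [P [f [g [P_proj fg /finite_projdimE[n Kn]]]]]].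
by exists n.+1, K, P, f, g.
Qed.

Lemma finite_injdim_hull M : finite_injdim M <->
  exists E C (f : {linear M -> E}) (g : {linear E -> C}),
    [/\ is_injective E, ses f g & finite_injdim C].
Proof.
rewrite finite_injdimE; split=> [[n /(id_lt_mono (leqnSn n))]|].
  move=> [E [C [f [g [E_inj fg Cn]]]]]; exists E, C, f, g; split=> //.
  by apply/finite_injdimE; exists n.
move=> [E [C [f [g [E_inj fg /finite_injdimE[n Cn]]]]]].
by exists n.+1, E, C, f, g.
Qed.

(** Extensions are the horseshoe lemma, and the other cases reduce to them. For a quotient [W], a
    cover of [V] also covers [W], with kernel an extension of [U]. For a kernel [U], pull back along
    a cover [Q] of [W]: the result [Y] is an extension of [V], and it maps onto [Q] with kernel [U].
    A cover [P] of [Y] then restricts to a cover of [U] by the kernel of [P] onto [Q], which is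
    projective. *)
Lemma finite_projdim_thick : thick (@finite_projdim A).
Proof.
split=> [U U0|U V W f g fg FV FW|U V W f g|U V W f g fg FU FV].
- by apply/finite_projdimE; exists 0%N.
- have [K [Q [k [q [Q_proj kq FK]]]]] := (finite_projdim_cover W).1 FW.
  have [Y [a [b [c [d [ab cd]]]]]] := ses_pullback fg kq.
  have FY := finite_projdim_ext cd FK FV.
  have [L [P [l [p [P_proj lp FL]]]]] := (finite_projdim_cover Y).1 FY.
  have [N [n [h [a' [b' [nh ab']]]]]] := ses_kernel_comp ab lp.
  apply/finite_projdim_cover; exists L, N, a', b'; split=> //.
  exact: projective_ses_kernel nh P_proj Q_proj.
- exact: finite_projdim_ext.
- have [K [Q [k [q [Q_proj kq FK]]]]] := (finite_projdim_cover V).1 FV.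
  have [N [n [h [a [b [nh ab]]]]]] := ses_kernel_comp fg kq.
  apply/finite_projdim_cover; exists N, Q, n, h; split=> //.
  exact: finite_projdim_ext ab FK FU.
Qed.

(** Dual argument: kernels use a hull of the middle term, and quotients use the pushout along a hull
    of [U], whose own hull modulo the hull of [U] is injective and contains [W]. *)
Lemma finite_injdim_thick : thick (@finite_injdim A).
Proof.
split=> [U U0|U V W f g fg FV FW|U V W f g|U V W f g fg FU FV].
- by apply/finite_injdimE; exists 0%N.
- have [E [C [e [c [E_inj ec FC]]]]] := (finite_injdim_hull V).1 FV.
  have [N [h [n [a [b [hn ab]]]]]] := ses_cokernel_comp fg ec.
  apply/finite_injdim_hull; exists E, N, h, n; split=> //.
  exact: finite_injdim_ext ab FW FC.
- exact: finite_injdim_ext.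
- have [E [C [e [c [E_inj ec FC]]]]] := (finite_injdim_hull U).1 FU.
  have [Y [a [b [j [q [ab jq]]]]]] := ses_pushout fg ec.
  have FY := finite_injdim_ext jq FV FC.
  have [G [D [k [p [G_inj kp FD]]]]] := (finite_injdim_hull Y).1 FY.
  have [N [h [n [a' [b' [hn ab']]]]]] := ses_cokernel_comp ab kp.
  apply/finite_injdim_hull; exists N, D, a', b'; split=> //.
  exact: injective_ses_cokernel hn E_inj G_inj.
Qed.

End Modules.

(** * The Koszul complex *)

Section Koszul.
Variables (A : comNzRingType) (M : lmodType A) (m : nat) (u : 'I_m -> A).

(** The diagonal drops out and the remaining terms are paired over [k < l]. Pairing is used because
    [V] may have 2-torsion, so a sum equal to its own negative need not vanish. *)
Lemma sum_antisym (V : zmodType) (G : 'I_m -> 'I_m -> V) :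
  (forall k, G k k = 0) ->
  (forall k l : 'I_m, (k < l)%N -> G k l + G l k = 0) ->
  \sum_k \sum_l G k l = 0.
Proof.
move=> G0 GN.
have -> : \sum_k \sum_l G k l =
    \sum_(k : 'I_m) \sum_(l : 'I_m | (k < l)%N) (G k l + G l k).
  under [RHS]eq_bigr do rewrite big_split /=.
  rewrite big_split /= [X in _ = _ + X](exchange_big_dep xpredT) //=.
  rewrite -big_split /=.
  apply: eq_bigr => k _; rewrite (bigID (fun l : 'I_m => (k < l)%N)) /=.
  congr (_ + _); rewrite (bigD1 k) ?ltnn //= G0 add0r.
  by apply: eq_bigl => l; rewrite -leqNgt ltn_neqAle andbC.
by apply: big1 => k _; apply: big1 => l; apply: GN.
Qed.

Let sgn (S : {set 'I_m}) (k : 'I_m) := #|[set l in S | (l < k)%N]%SET|.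

(** Of two distinct indices exactly one precedes the other, so removing them in either order yields
    opposite Koszul signs. *)
Lemma sgn_setD1 (S : {set 'I_m}) (k l : 'I_m) :
  k \in S -> sgn S l = ((k < l)%N + sgn (S :\ k) l)%N.
Proof.
move=> kS; rewrite /sgn (cardsD1 k) inE kS; congr (_ + #|(_ : {set _})|)%N.
by apply/setP => x; rewrite !inE andbA.
Qed.

Lemma koszul_diff_comp (j : int) c :
  koszul_diff M u j (j - 1) (koszul_diff M u (j + 1) j c) = 0.
Proof.
apply/ffunP => T; rewrite ffunE [RHS]ffunE.
(* The contribution of removing first [k] and then [l] from [S], extended by zero to all pairs so
   that the antisymmetric sum applies. *)
pose G (S : {S : {set 'I_m} | #|S|%:Z == j + 1}) (k l : 'I_m) : M :=
  if [&& k \in val S, l \in val S :\ k & (val S :\ k :\ l)%SET == val T]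
  then ((-1) ^+ (sgn (val S) k + sgn (val S :\ k) l) * (u k * u l)) *: c S
  else 0.
transitivity (\sum_S \sum_k \sum_l G S k l); last first.
  apply: big1 => S _; apply: sum_antisym => [k|k l kl].
    by rewrite /G !inE eqxx andbF.
  rewrite /G !inE (eq_sym l k) [in X in _ + X]finset.setDDl.
  rewrite finset.setUC -finset.setDDl.
  have kl' : k != l by rewrite -val_eqE neq_ltn kl.
  rewrite kl' /=; have [kS|] := boolP (k \in val S); last first.
    by rewrite andbF addr0.
  have [lS|] := boolP (l \in val S); last by rewrite addr0.
  case: ifP => _; last by rewrite addr0.
  rewrite -scalerDl (sgn_setD1 l kS) (sgn_setD1 k lS) kl.
  rewrite ltnNge (ltnW kl) /= add0n add1n.
  rewrite [X in X *: _](_ : _ = 0) ?scale0r //.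
  rewrite (mulrC (u l)) -mulrDl addSn addnC exprS.
  by rewrite mulN1r subrr mul0r.
transitivity (\sum_(S' : {S' : {set 'I_m} | #|S'|%:Z == j})
    \sum_(S : {S : {set 'I_m} | #|S|%:Z == j + 1})
    \sum_(k in val S | (val S :\ k)%SET == val S')
    \sum_(l in val S' | (val S' :\ l)%SET == val T)
      ((-1) ^+ (sgn (val S) k + sgn (val S') l) * (u k * u l)) *: c S).
  apply: eq_bigr => S' _.
  transitivity (\sum_(l in val S' | (val S' :\ l)%SET == val T)
    \sum_(S : {S : {set 'I_m} | #|S|%:Z == j + 1})
    \sum_(k in val S | (val S :\ k)%SET == val S')
      ((-1) ^+ (sgn (val S) k + sgn (val S') l) * (u k * u l)) *: c S).
    apply: eq_bigr => l _; rewrite ffunE scaler_sumr.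
    apply: eq_bigr => S _; rewrite scaler_sumr.
    apply: eq_bigr => k _; rewrite scalerA exprD; congr (_ *: _).
    by rewrite mulrACA [X in X * _]mulrC [X in _ * X]mulrC.
  by rewrite exchange_big; apply: eq_bigr => S _; rewrite exchange_big.
rewrite exchange_big; apply: eq_bigr => S _ /=.
rewrite (exchange_big_dep xpredT) //=; apply: eq_bigr => k _.
have [kS|kS] := boolP (k \in val S); last first.
  by rewrite !big1 // => l _; rewrite /G (negPf kS).
have cardSk : #|val S :\ k|%:Z == j.
  have /eqP := valP S; rewrite (cardsD1 k) kS PoszD addrC => /addIr ->.
  exact: eqxx.
(* The intermediate set is determined by [S] and [k], so the sum over [S'] collapses to this
   term. *)
pose S0 : {S' : {set 'I_m} | #|S'|%:Z == j} :=
  exist (fun S' : {set 'I_m} => #|S'|%:Z == j) _ cardSk.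
rewrite (big_pred1 S0) => [|S']; last by rewrite -val_eqE eq_sym.
by rewrite [LHS]big_mkcond; apply: eq_bigr => l _; rewrite /G kS.
Qed.

(** Each chain module is a finite power of [M], and it is zero outside degrees [0] to [m] since no
    subset has such a cardinality. *)
Lemma koszul_homology_thick (F : lmodType A -> Prop) (i : int) :
  thick F -> F M ->
  (forall j : int, j <> i -> F (koszul_homology M u j)) ->
  F (koszul_homology M u i).
Proof.
move=> F_thick FM FH.
pose d j k : {linear koszul_chain M m j -> koszul_chain M m k} :=
  koszul_diff M u j k.
apply: (@complex_homology_thick A F F_thick (koszul_chain M m) d m i) => //.
- exact: koszul_diff_comp.
- move=> j j0 c; apply/ffunP => S; exfalso; have /eqP cardS := valP S.
  by move: j0; rewrite -cardS.
- move=> j mj c; apply/ffunP => S; exfalso; have /eqP cardS := valP S.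
  move: mj; rewrite -cardS ltz_nat ltnNge.
  by rewrite -[X in (_ <= X)%N]card_ord max_card.
- by move=> j; apply: thick_ffun.
Qed.
End Koszul.

Theorem theorem1p4 (A : comNzRingType) (mm : set A)
    (A_noetherian : noetherian A) (A_local : is_local_ring mm)
    (M : lmodType A) (M_fg : finitely_generated M)
    (I : set A) (I_ideal : is_ideal I)
    (m : nat) (u : 'I_m -> A) (u_min : minimal_generators u I)
    (i : int) :
  (finite_projdim M ->
   (forall j : int, j <> i -> finite_projdim (koszul_homology M u j)) ->
   finite_projdim (koszul_homology M u i))
  /\
  (finite_injdim M ->
   (forall j : int, j <> i -> finite_injdim (koszul_homology M u j)) ->
   finite_injdim (koszul_homology M u i)).
Proof.
by split; apply: koszul_homology_thick;
  [apply: finite_projdim_thick | apply: finite_injdim_thick].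
Qed.
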